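(* There exist constants $c,C>0$ and $n_0$ such that for all integers $n\ge n_0$ and $0\le k\le n$, with $N=2^n$ and $K=2^k$, the bounded-error quantum query complexity $Q(H(k))$ of identifying the input oracle from the hybrid family $H(k)=\{f_a: a\in\{0,1\}^n\}$ satisfies $$c\sqrt{N/K}\le Q(H(k))\le C\sqrt{N/K}.$$ Here, for $a=(a_1,\dots,a_n)$ and $x=(x_1,\dots,x_n)$ in $\{0,1\}^n$, $f_a(x)=1$ if and only if (i) $(a_1,\dots,a_{n-k})=(x_1,\dots,x_{n-k})$ and (ii) $\sum_{i=n-k+1}^{n}a_ix_i\equiv 0\pmod 2$.
   Context: An oracle is a Boolean function $f:\{0,1\}^n\to\{0,1\}$. The oracle identification problem (OIP) for a set $S$ of distinct oracles: the set $S$ is completely known, an unknown $f\in S$ (the input oracle) is given as a black box, and the task is to determine which element of $S$ it is. A quantum algorithm with $t$ queries is a sequence $U_0,O_f,U_1,O_f,\dots,O_f,U_t$ applied to a fixed initial state (with arbitrary finite workspace), followed by a measurement producing the output, where the $U_j$ are arbitrary unitaries independent of $f$ and $O_f$ maps $|x\rangle|b\rangle$ to $(-1)^{b\cdot f(x)}|x\rangle|b\rangle$ for $x\in\{0,1\}^n$, $b\in\{0,1\}$ (identity on the rest of the workspace). It solves the OIP for $S$ with bounded error if for every $f\in S$, when run with $O_f$, it outputs (the index of) $f$ with probability at least $2/3$. $Q(S)$ is the minimum $t$ for which such an algorithm exists. *)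

(* Defs.v *)
From HB Require Import structures.
From mathcomp Require Import all_boot all_order all_algebra.
From mathcomp Require Import reals.
From mathcomp Require Export complex.

Set Implicit Arguments.
Unset Strict Implicit.
Unset Printing Implicit Defensive.

Import Order.TTheory GRing.Theory Num.Theory.
Local Open Scope ring_scope.
Local Open Scope sesquilinear_scope.
Local Open Scope complex_scope.

Definition bits (n : nat) := {ffun 'I_n -> bool}.

Definition oracle (n : nat) := {ffun bits n -> bool}.

(* Labels (x, b, w) of the computational basis states |x>|b>|w>.  State vectors
   are column vectors indexed by 'I_#|basis n W|, whose i-th coordinate is the
   amplitude of the label [enum_val i]. *)
Definition basis (n : nat) (W : finType) : finType := (bits n * bool * W)%type.

Definition oracle_mx (R : realType) (n : nat) (W : finType) (f : oracle n) :
    'M[R[i]]_#|basis n W| :=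
  diag_mx (\row_i let: (x, b, _) := enum_val i in (-1) ^+ (b && f x)).

Definition normsq (R : realType) (d : nat) (v : 'cV[R[i]]_d) : R[i] :=
  \sum_i `|v i 0| ^+ 2.

(* The measurement is a general quantum measurement, given by operators M_g with
   sum_g M_g^* M_g = 1, whose outcomes g are the oracles on n bits; on a state v
   the outcome g has probability |M_g v|^2.  Measuring the computational basis
   and post-processing the result classically is the special case in which every
   M_g is the projection onto a set of basis vectors. *)
Record qalgorithm (R : realType) (n t : nat) := QAlgorithm {
  workspace : finType;
  init_state : 'cV[R[i]]_#|basis n workspace|;
  step : 'I_t.+1 -> 'M[R[i]]_#|basis n workspace|;
  meas : oracle n -> 'M[R[i]]_#|basis n workspace|;
  init_state_unit : normsq init_state = 1;
  step_unitary : forall j, step j \is unitarymx;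
  meas_complete : \sum_g (meas g)^t* *m meas g = 1%:M
}.

(* state after U_0, O_f, U_1, ..., O_f, U_j (meant for j <= t) *)
Fixpoint state_after (R : realType) (n t : nat) (A : qalgorithm R n t)
    (f : oracle n) (j : nat) : 'cV[R[i]]_#|basis n (workspace A)| :=
  match j with
  | 0 => step A ord0 *m init_state A
  | j'.+1 => step A (inord j'.+1) *m
               (oracle_mx R (workspace A) f *m state_after A f j')
  end.

Definition output_prob (R : realType) (n t : nat) (A : qalgorithm R n t)
    (f g : oracle n) : R[i] :=
  normsq (meas A g *m state_after A f t).

(* Both sides are real elements of R[i], on which its order is that of R. *)
Definition solves_OIP (R : realType) (n t : nat) (A : qalgorithm R n t)
    (S : {set oracle n}) : Prop :=
  forall f, f \in S -> 2 / 3 <= output_prob A f f.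

(* q is the least t such that some t-query algorithm solves the OIP for S,
   i.e. Q(S) = q; in particular such an algorithm exists. *)
Definition is_query_complexity (R : realType) (n : nat) (S : {set oracle n})
    (q : nat) : Prop :=
  (exists A : qalgorithm R n q, solves_OIP A S) /\
  (forall t, (exists A : qalgorithm R n t, solves_OIP A S) -> (q <= t)%N).

(* The coordinates a_1, ..., a_n are numbered from 0: a_i is a (i - 1). *)
Definition hybrid_oracle (n k : nat) (a : bits n) : oracle n :=
  [ffun x : bits n =>
     [forall i : 'I_n, (i < n - k)%N ==> (a i == x i)] &&
     (\sum_(i < n | (n - k <= i)%N) a i * x i == 0 %[mod 2])%N].

Definition hybrid (n k : nat) : {set oracle n} :=
  [set hybrid_oracle k a | a : bits n].

(* Main.v *)
(* Put M = 2^(n-k), the number of prefixes (a_1, ..., a_(n-k)).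

   Upper bound.  On inputs whose last k bits vanish, f_a is the indicator of the
   prefix of a, so Grover's algorithm finds that prefix with t = O(sqrt M)
   queries.  The search is exact: an extra basis state that is never queried
   makes the angle theta between the start state and the unmarked states
   adjustable below arcsin(1 / sqrt M), and it is taken equal to
   pi / (2(2t+1)).  One more query between two Hadamard transforms of the suffix
   register then reveals the suffix of a, as in the algorithm of Bernstein and
   Vazirani.

   Lower bound.  The oracles with zero suffix are the indicators of M disjoint
   sets.  By the hybrid argument of Bennett, Bernstein, Brassard and Vazirani,
   the squared distances between the final states for these oracles and for the
   zero oracle sum to at most 4 t^2, while the M output probabilities for the
   zero oracle sum to at most 1; hence 2M/3 <= 2 + 8 t^2.  When M is small one
   only needs t > 0, which holds because H(k) has two elements. *)
Require Import Defs.
From mathcomp Require Import all_boot all_order all_algebra.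
From mathcomp Require Import reals.
From mathcomp Require Import boolp topology normedtype derive trigo.
From mathcomp Require Import ring lra zify.
(* [topology] also defines a constant named [basis]. *)
Import Defs.

Set Implicit Arguments.
Unset Strict Implicit.
Unset Printing Implicit Defensive.

Import Order.TTheory GRing.Theory Num.Theory.
Import numFieldNormedType.Exports.
Local Open Scope ring_scope.
Local Open Scope sesquilinear_scope.
Local Open Scope complex_scope.

(** * Squared norms *)

(** After the triangle inequality, the gap is the perfect square [(|a| - j|b|)^2]. *)
Lemma sqr_normD_weighted (C : numDomainType) (j : nat) (a b : C) :
  j%:R * `|a + b| ^+ 2 <= j.+1%:R * `|a| ^+ 2 + (j * j.+1)%:R * `|b| ^+ 2.
Proof.
apply: (@le_trans _ _ (j%:R * (`|a| + `|b|) ^+ 2)).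
  by rewrite ler_wpM2l // lerXn2r ?nnegrE ?addr_ge0 // ler_normD.
rewrite -subr_ge0 natrM -natr1.
have -> : (j%:R + 1) * `|a| ^+ 2 + j%:R * (j%:R + 1) * `|b| ^+ 2
    - j%:R * (`|a| + `|b|) ^+ 2 = (`|a| - j%:R * `|b|) ^+ 2 :> C by ring.
by rewrite real_exprn_even_ge0 // rpredB ?rpredM ?normr_real ?realn.
Qed.

Section Norm.
Variable R : realType.
Implicit Types d : nat.

Lemma normsqE d (v : 'cV[R[i]]_d) : normsq v = (v^t* *m v) 0 0.
Proof.
rewrite mxE; apply: eq_bigr => i _.
by rewrite !mxE normCK mulrC.
Qed.

Lemma normsq_ge0 d (v : 'cV[R[i]]_d) : 0 <= normsq v.
Proof. by apply: sumr_ge0 => i _; rewrite exprn_ge0. Qed.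

Lemma normsq0 d : normsq (0 : 'cV[R[i]]_d) = 0.
Proof. by apply: big1 => i _; rewrite mxE normr0 expr0n. Qed.

Lemma normsq_unitary d (U : 'M[R[i]]_d) v :
  U \is unitarymx -> normsq (U *m v) = normsq v.
Proof.
move=> Uu; rewrite !normsqE trmx_mul map_mxM mulmxA.
by rewrite mulmxKtV.
Qed.

Lemma normsq_measurement d (I : finType) (M : I -> 'M[R[i]]_d) v :
  \sum_g (M g)^t* *m M g = 1%:M -> \sum_g normsq (M g *m v) = normsq v.
Proof.
move=> M1; rewrite normsqE -[v in _ *m v]mul1mx -M1 mulmx_suml mulmx_sumr summxE.
apply: eq_bigr => g _.
by rewrite normsqE trmx_mul map_mxM !mulmxA.
Qed.

Lemma normsqD_weighted d (j : nat) (a b : 'cV[R[i]]_d) :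
  j%:R * normsq (a + b) <= j.+1%:R * normsq a + (j * j.+1)%:R * normsq b.
Proof.
rewrite /normsq !mulr_sumr -big_split /=; apply: ler_sum => i _.
by rewrite mxE sqr_normD_weighted.
Qed.

Lemma normsqD_le d (a b : 'cV[R[i]]_d) :
  normsq (a + b) <= 2 * normsq a + 2 * normsq b.
Proof. by have := normsqD_weighted 1 a b; rewrite mul1r mul1n. Qed.

End Norm.

(** * The hybrid argument *)

Section Hybrid_argument.
Variables (R : realType) (n t : nat) (A : qalgorithm R n t).
Implicit Types f : oracle n.

Let no_oracle : oracle n := [ffun=> false].

Lemma oracle_mxE (W : finType) f (v : 'cV[R[i]]_#|basis n W|) i :
  (oracle_mx R W f *m v) i 0 =
  (-1) ^+ ((enum_val i).1.2 && f (enum_val i).1.1) * v i 0.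
Proof.
rewrite /oracle_mx mul_diag_mx !mxE.
by case: (enum_val i) => [[x b] w].
Qed.

Lemma oracle_mx_false (W : finType) : oracle_mx R W no_oracle = 1%:M.
Proof.
rewrite -diag_const_mx; congr diag_mx; apply/rowP => i; rewrite !mxE.
by case: (enum_val i) => [[x b] w]; rewrite ffunE andbF.
Qed.

Lemma normsq_oracle (W : finType) f (v : 'cV[R[i]]_#|basis n W|) :
  normsq (oracle_mx R W f *m v) = normsq v.
Proof. by apply: eq_bigr => i _; rewrite oracle_mxE normrMsign. Qed.

Lemma normsq_state f j : normsq (state_after A f j) = 1.
Proof.
elim: j => [|j IH] /=; rewrite normsq_unitary ?step_unitary //.
  exact: init_state_unit.
by rewrite normsq_oracle.
Qed.

Lemma sum_output_prob f : \sum_g output_prob A f g = 1.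
Proof. by rewrite (normsq_measurement _ (meas_complete A)) normsq_state. Qed.

Let kick f j := (oracle_mx R (workspace A) f - 1%:M) *m state_after A no_oracle j.

(* Telescoping over the queries; the factor [j] replaces the triangle
   inequality and Cauchy-Schwarz. *)
Lemma normsq_state_dist f j :
  normsq (state_after A f j - state_after A no_oracle j) <=
  j%:R * \sum_(i < j) normsq (kick f i).
Proof.
elim: j => [|j IH]; first by rewrite subrr normsq0 mul0r.
have -> : state_after A f j.+1 - state_after A no_oracle j.+1 =
  step A (inord j.+1) *m (oracle_mx R (workspace A) f *m
    (state_after A f j - state_after A no_oracle j) + kick f j).
  rewrite /= oracle_mx_false mul1mx -mulmxBr; congr (_ *m _).
  by rewrite /kick mulmxBr mulmxBl mul1mx addrA subrK.
rewrite normsq_unitary ?step_unitary //.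
(* With weight 0 the weighted inequality says nothing, so the first query is treated apart: there
   the states agree and only the kick remains. *)
case: j IH => [|j] IH.
  by rewrite subrr mulmx0 add0r mul1r big_ord1.
have j0 : 0 < j.+1%:R :> R[i] by rewrite ltr0n.
rewrite -(ler_pM2l j0); apply: le_trans (normsqD_weighted _ _ _) _.
rewrite normsq_oracle big_ord_recr /= mulrA -natrM mulrDr lerD2r.
by rewrite mulnC natrM -mulrA ler_wpM2l.
Qed.

Variables (I : finType) (F : I -> oracle n).
Hypothesis F_disjoint : forall x p q, F p x -> F q x -> p = q.

(** At each label at most one of the disjoint oracles flips the sign; its kick is -2 times the
    amplitude, hence the factor 4. *)
Lemma sum_kick j : \sum_p normsq (kick (F p) j) <= 4.
Proof.
have -> : 4 = 4 * normsq (state_after A no_oracle j) :> R[i].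
  by rewrite normsq_state mulr1.
rewrite /normsq exchange_big mulr_sumr /=.
apply: ler_sum => i _.
under eq_bigr => p _.
  have -> : kick (F p) j i 0 = ((-1) ^+ ((enum_val i).1.2 && F p (enum_val i).1.1) - 1)
      * state_after A no_oracle j i 0.
    by rewrite mulrBl mul1r -oracle_mxE /kick mulmxBl mul1mx !mxE.
  rewrite normrM exprMn.
  over.
rewrite -mulr_suml; apply: ler_wpM2r; first by rewrite exprn_ge0.
case: (enum_val i).1 => x b /=.
case: (pickP (fun p => F p x)) => [q Fq|F0].
  rewrite (bigD1 q) //= big1 ?addr0.
    case: b; rewrite /= ?Fq ?expr0 ?subrr ?normr0 ?expr0n ?ler0n //=.
    have -> : (-1) ^+ 1 - 1 = - 2%:R :> R[i] by ring.
    by rewrite normrN normr_nat -natrX ler_nat.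
  move=> p pq; case Fp : (F p x); first by rewrite (F_disjoint Fp Fq) eqxx in pq.
  by rewrite andbF expr0 subrr normr0 expr0n.
rewrite big1 ?ler0n // => p _.
by rewrite F0 andbF expr0 subrr normr0 expr0n.
Qed.

Hypothesis F_inj : injective F.
Hypothesis A_solves : forall p, 2 / 3 <= output_prob A (F p) (F p).

Lemma card_le_sqr_queries : (#|I| <= 12 * t ^ 2 + 3)%N.
Proof.
pose d p := normsq (state_after A (F p) t - state_after A no_oracle t).
have meas_le g v : normsq (meas A g *m v) <= normsq v.
  rewrite -(normsq_measurement v (meas_complete A)) (bigD1 g) //= lerDl.
  by apply: sumr_ge0 => h _; apply: normsq_ge0.
(* Measurement operators are contractions, so passing to the run on the zero oracle costs a factor 2
   and an additive [2 * d p]. *)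
have one p : 2 / 3 <= 2 * output_prob A no_oracle (F p) + 2 * d p.
  apply: le_trans (A_solves p) _; rewrite /output_prob.
  rewrite -[state_after A (F p) t](subrK (state_after A no_oracle t)) addrC mulmxDr.
  apply: le_trans (normsqD_le _ _) _.
  by rewrite lerD2l ler_wpM2l.
have sum_d : \sum_p d p <= (4 * t ^ 2)%:R.
  apply: (@le_trans _ _ (\sum_p t%:R * \sum_(i < t) normsq (kick (F p) i))).
    by apply: ler_sum => p _; apply: normsq_state_dist.
  rewrite -mulr_sumr exchange_big /=.
  apply: (@le_trans _ _ (t%:R * \sum_(i < t) 4)).
    by rewrite ler_wpM2l //; apply: ler_sum => i _; apply: sum_kick.
  rewrite sumr_const card_ord -[4 *+ t]mulr_natr natrM natrX.
  by have -> : t%:R * (4 * t%:R) = 4 * t%:R ^+ 2 :> R[i] by ring.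
(* Injectivity of [F] makes these probabilities of distinct outcomes of one measurement. *)
have sum_prob : \sum_p output_prob A no_oracle (F p) <= 1.
  rewrite -(sum_output_prob no_oracle) -(big_image _ _ _ _ (fun g => output_prob A no_oracle g)) /=.
  rewrite [leRHS](bigID (mem (codom F))) /= big_uniq ?lerDl /=; last first.
    by rewrite map_inj_uniq ?enum_uniq.
  by apply: sumr_ge0 => h _; apply: normsq_ge0.
have : \sum_(p : I) (2 / 3 : R[i]) <= 2 * 1 + 2 * (4 * t ^ 2)%:R.
  apply: le_trans (_ : _ <= \sum_p (2 * output_prob A no_oracle (F p) + 2 * d p)) _.
    by apply: ler_sum => p _; apply: one.
  by rewrite big_split /= -!mulr_sumr lerD // ler_wpM2l.
rewrite sumr_const -[leLHS]mulr_natr => h.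
have : (2 * #|I|)%:R <= (6 + 24 * t ^ 2)%:R :> R[i].
  have -> : (2 * #|I|)%:R = 3 * (2 / 3 * #|I|%:R) :> R[i].
    by rewrite natrM; field.
  have -> : (6 + 24 * t ^ 2)%:R = 3 * (2 * 1 + 2 * (4 * t ^ 2)%:R) :> R[i].
    by rewrite natrD !natrM; ring.
  by rewrite ler_wpM2l.
rewrite ler_nat; lia.
Qed.

End Hybrid_argument.

(** * Prefixes and suffixes *)

Section Prefixes.
Variables n k : nat.
Implicit Types a x y z : bits n.

(** A prefix is represented by the full string with zero suffix, so that it can itself serve as an
    input or as a hidden string. *)
Definition prefix_part a : bits n := [ffun i : 'I_n => (i < n - k)%N && a i].

Definition is_prefix x := prefix_part x == x.

Lemma prefix_partK a : is_prefix (prefix_part a).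
Proof. by apply/eqP/ffunP => i; rewrite !ffunE andbA andbb. Qed.

Lemma is_prefixF x (i : 'I_n) : is_prefix x -> (n - k <= i)%N -> x i = false.
Proof. by move=> /eqP <-; rewrite ffunE leqNgt => /negbTE ->. Qed.

Lemma same_prefixE a x :
  [forall i : 'I_n, (i < n - k)%N ==> (a i == x i)] = (prefix_part a == prefix_part x).
Proof.
apply/forallP/eqP => [ax|ax i].
  apply/ffunP => i; rewrite !ffunE; have := ax i.
  by case: (_ < _)%N => //= /eqP.
by apply/implyP => ik; move/ffunP: ax => /(_ i); rewrite !ffunE ik /= => ->.
Qed.

Lemma hybrid_oracle_prefixl a x :
  is_prefix a -> hybrid_oracle k a x = (a == prefix_part x).
Proof.
move=> pa; rewrite ffunE same_prefixE (eqP pa) big1 ?eqxx ?andbT // => i ik.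
by rewrite (is_prefixF pa).
Qed.

Lemma hybrid_oracle_prefixr a x :
  is_prefix x -> hybrid_oracle k a x = (prefix_part a == x).
Proof.
move=> px; rewrite ffunE same_prefixE (eqP px) big1 ?eqxx ?andbT // => i ik.
by rewrite (is_prefixF px) // muln0.
Qed.

(** The indicator of [is_prefix] is a product over coordinates, so the count factors into 2 per
    prefix position and 1 per suffix position. *)
Lemma card_prefix : (k <= n)%N -> #|[pred x | is_prefix x]| = (2 ^ (n - k))%N.
Proof.
move=> kn; rewrite -sum1_card big_mkcond /=.
have E x : (if is_prefix x then 1 else 0)%N =
    (\prod_(i < n) ((i < n - k) || ~~ x i : nat))%N.
  have -> : is_prefix x = [forall i : 'I_n, (i < n - k)%N || ~~ x i].
    apply/eqP/forallP => [<- i|h].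
      by rewrite ffunE; case: (_ < _)%N.
    apply/ffunP => i; rewrite ffunE; have := h i.
    by case: (_ < _)%N => //= /negbTE.
  case: forallP => [h|/forallP].
    by rewrite big1 // => i _; rewrite h.
  by rewrite negb_forall => /existsP [i /negbTE hi]; rewrite (bigD1 i) //= hi.
rewrite (eq_bigr _ (fun x _ => E x)).
rewrite -(bigA_distr_bigA (fun (i : 'I_n) b => ((i < n - k) || ~~ b : nat))%N).
rewrite (eq_bigr (fun i : 'I_n => if (i < n - k)%N then 2%N else 1%N)); last first.
  by move=> i _; rewrite big_bool; case: (_ < _)%N.
rewrite -big_mkcond /= prod_nat_const; congr (_ ^ _)%N.
rewrite -sum1_card -[LHS](big_ord_widen _ (fun=> 1%N)) ?leq_subr //.
by rewrite sum1_card card_ord.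
Qed.

End Prefixes.

(** * Hadamard transform of the suffix register *)

Section Suffix_Hadamard.
Variables (R : realType) (n k : nat).
Implicit Types a x y z : bits n.

(* Tensor factor of the transform that is the identity on the prefix register
   and the Hadamard transform on the suffix register. *)
Definition hadamard_factor (i : 'I_n) (u v : bool) : R :=
  if (i < n - k)%N then (u == v)%:R else (Num.sqrt 2)^-1 * (-1) ^+ (u && v).

Definition hadamard x y : R := \prod_i hadamard_factor i (x i) (y i).

Lemma hadamardC x y : hadamard x y = hadamard y x.
Proof. by apply: eq_bigr => i _; rewrite /hadamard_factor andbC eq_sym. Qed.

(** The sum over strings factors into coordinates, each giving the orthogonality relation of a 2 by
    2 identity or Hadamard matrix. *)
Lemma hadamard_orth x z : \sum_y hadamard x y * hadamard z y = (x == z)%:R.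
Proof.
under eq_bigr => y _ do rewrite -big_split /=.
rewrite -(bigA_distr_bigA (fun (i : 'I_n) b =>
  hadamard_factor i (x i) b * hadamard_factor i (z i) b)).
have E i : \sum_b hadamard_factor i (x i) b * hadamard_factor i (z i) b = (x i == z i)%:R.
  rewrite big_bool /hadamard_factor; case: (_ < _)%N.
    by case: (x i); case: (z i); rewrite /= !(mulr0, mul0r, mulr1, addr0, add0r).
  have s2 : (Num.sqrt 2)^-1 * (Num.sqrt 2)^-1 = 2^-1 :> R.
    by rewrite -invfM -expr2 sqr_sqrtr.
  case: (x i); case: (z i); rewrite /= ?expr1 ?expr0 ?mulr1 ?mulrN1 ?mulrNN ?mulNr ?mulrN s2;
    by [rewrite -div1r -splitr | rewrite subrr | rewrite addNr].
rewrite (eq_bigr _ (fun i _ => E i)).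
case: eqP => [->|xz]; first by rewrite big1 // => i _; rewrite eqxx.
have [i xzi] : exists i, x i != z i.
  apply/existsP; rewrite -negb_forall; apply/negP => /forallP h.
  by apply: xz; apply/ffunP => i; apply/eqP.
by rewrite (bigD1 i) //= (negbTE xzi) mul0r.
Qed.

(* The phase query shifts the character of the suffix from 0 to that of [a];
   the global sign appears since [f_a] is 1 on even inner products. *)
Lemma oracle_hadamard a y :
  (-1) ^+ (hybrid_oracle k a y) * hadamard y (prefix_part k a) = - hadamard y a.
Proof.
(* If the prefixes differ, a delta factor makes both sides zero. *)
rewrite ffunE; case: forallP => [h|/forallP]; last first.
  rewrite negb_forall; case/existsP => i; rewrite negb_imply => /andP [ik ai].
  rewrite /hadamard !(bigD1 i (P := predT)) //= /hadamard_factor ffunE ik /=.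
  by rewrite eq_sym (negbTE ai) !mul0r mulr0 oppr0.
have E : hadamard y a = hadamard y (prefix_part k a) *
    (-1) ^+ (\sum_(i < n | (n - k <= i)%N) a i * y i)%N.
  rewrite -prodrXr [X in _ * X]big_mkcond -big_split /=; apply: eq_bigr => i _.
  rewrite /hadamard_factor ffunE [(n - k <= i)%N]leqNgt; case: (_ < _)%N; rewrite /= ?mulr1 //.
  by rewrite andbF expr0 mulr1 mulnb andbC.
rewrite E modn2 mod0n eqb0; set s := (\sum_(i < n | _) _)%N.
rewrite -[(-1) ^+ s]signr_odd.
by case: (odd s); rewrite /= ?expr0 ?expr1 ?mulr1 ?mul1r ?mulrN1 ?mulN1r ?opprK.
Qed.

End Suffix_Hadamard.

(** * The rotation angle *)

Section Grover_angle.
Variables (R : realType) (t : nat).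

(* [t] Grover rotations by [2 * angle], starting at [angle], end at [pi / 2]. *)
Definition angle : R := pi / 2 / (2 * t%:R + 1).

Lemma sin_le (x : R) : 0 <= x -> sin x <= x.
Proof.
move=> x0.
have [c _] : exists2 c, c \in `[0, x] & sin x - sin 0 = cos c * (x - 0).
  apply: MVT_segment => //.
  by apply: continuous_subspaceT => y; apply: continuous_sin.
by rewrite sin0 !subr0 => ->; rewrite ler_piMl // cos_le1.
Qed.

Let m0 : 0 < (2 * t%:R + 1) :> R. Proof. by rewrite ltr_wpDl // mulr_ge0. Qed.

Lemma angle_end : (2 * t%:R + 1) * angle = pi / 2.
Proof. by rewrite mulrC divfK // gt_eqF. Qed.

Lemma angle_ge0 : 0 <= angle.
Proof. by rewrite !divr_ge0 ?pi_ge0 // ltW. Qed.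

Hypothesis t0 : (0 < t)%N.

Lemma angle_lt : angle < pi / 2.
Proof.
rewrite -angle_end -[ltLHS]mul1r ltr_pM2r; last by rewrite !divr_gt0 ?pi_gt0.
by rewrite ltrDr mulr_gt0 ?ltr0n.
Qed.

Lemma cos_angle_gt0 : 0 < cos angle.
Proof.
apply: cos_gt0_pihalf; rewrite angle_lt andbT (lt_le_trans _ angle_ge0) //.
by rewrite oppr_lt0 divr_gt0 ?pi_gt0.
Qed.

Lemma sqr_sin_angle M : (M <= t ^ 2)%N -> M%:R * sin angle ^+ 2 <= 1.
Proof.
move=> Mt.
have s0 : 0 <= sin angle.
  apply: sin_ge0_pi; rewrite angle_ge0 (le_trans (ltW angle_lt)) //.
  by rewrite ler_pdivrMr // ler_peMr ?pi_ge0 // ler1n.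
(* Here [sin angle <= angle] and [2t * angle <= (2t+1) * angle = pi/2 < 2]. *)
have st : t%:R * sin angle <= 1.
  have h1 := sin_le angle_ge0; have h2 := angle_end; have := pihalf_lt2 R.
  rewrite -{}h2; have := angle_ge0.
  have : 0 <= t%:R :> R by rewrite ler0n.
  set a := angle in h1 *; set s := sin a in s0 h1 *; nra.
apply: (@le_trans _ _ ((t%:R * sin angle) ^+ 2)).
  by rewrite exprMn ler_wpM2r ?exprn_ge0 // -natrX ler_nat.
by rewrite exprn_ile1 // mulr_ge0.
Qed.

(** Sum and difference formulas around the midpoint [(2j+2) * angle], whose cosine is the inner
    product taken by the reflection in [grover_iteration]. *)
Lemma sin_step j : sin ((2 * j.+1%:R + 1) * angle) =
  sin ((2 * j%:R + 1) * angle)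
    + 2 * cos ((2 * j%:R + 2) * angle) * sin angle.
Proof.
have -> : (2 * j.+1%:R + 1) * angle = (2 * j%:R + 2) * angle + angle.
  by rewrite -natr1; ring.
have -> : (2 * j%:R + 1) * angle = (2 * j%:R + 2) * angle - angle.
  by ring.
by rewrite sinD sinB; ring.
Qed.

Lemma cos_step j : cos ((2 * j.+1%:R + 1) * angle) =
  2 * cos ((2 * j%:R + 2) * angle) * cos angle - cos ((2 * j%:R + 1) * angle).
Proof.
have -> : (2 * j.+1%:R + 1) * angle = (2 * j%:R + 2) * angle + angle.
  by rewrite -natr1; ring.
have -> : (2 * j%:R + 1) * angle = (2 * j%:R + 2) * angle - angle.
  by ring.
by rewrite cosD cosB; ring.
Qed.

Lemma cos_mid j : cos ((2 * j%:R + 2) * angle) =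
  cos ((2 * j%:R + 1) * angle) * cos angle
    - sin ((2 * j%:R + 1) * angle) * sin angle.
Proof.
have -> : (2 * j%:R + 2) * angle = (2 * j%:R + 1) * angle + angle.
  by ring.
exact: cosD.
Qed.

End Grover_angle.

(** * The identification algorithm *)

Section Real_matrices.
Variables (R : realType) (B : finType).
Implicit Types (v w : B -> R) (F G : B -> B -> R).

Definition rvec v : 'cV[R[i]]_#|B| := \col_i (v (enum_val i))%:C.

Definition rmx F : 'M[R[i]]_#|B| :=
  \matrix_(i, j) (F (enum_val i) (enum_val j))%:C.

Lemma sum_enum_val (V : nmodType) (f : B -> V) :
  \sum_(i < #|B|) f (enum_val i) = \sum_x f x.
Proof. by rewrite [RHS](reindex _ (onW_bij _ (@enum_val_bij B))). Qed.

Lemma eq_rvec v w : v =1 w -> rvec v = rvec w.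
Proof. by move=> vw; apply/colP => i; rewrite !mxE vw. Qed.

Lemma eq_rmx F G : F =2 G -> rmx F = rmx G.
Proof. by move=> FG; apply/matrixP => i j; rewrite !mxE FG. Qed.

Lemma rmx1 : rmx (fun x y => (x == y)%:R) = 1%:M.
Proof.
apply/matrixP => i j; rewrite !mxE (inj_eq enum_val_inj).
by case: eqP => _; rewrite ?rmorph1 ?rmorph0.
Qed.

Lemma mul_rmx_rvec F v :
  rmx F *m rvec v = rvec (fun x => \sum_y F x y * v y).
Proof.
apply/colP => i; rewrite !mxE -(sum_enum_val (fun y => _ * v y)) rmorph_sum.
by apply: eq_bigr => j _; rewrite !mxE rmorphM.
Qed.

Lemma mul_rmx F G :
  rmx F *m rmx G = rmx (fun x z => \sum_y F x y * G y z).
Proof.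
apply/matrixP => i j; rewrite !mxE -(sum_enum_val (fun y => _ * G y _)) rmorph_sum.
by apply: eq_bigr => y _; rewrite !mxE rmorphM.
Qed.

Lemma trmxC_rmx F : (rmx F)^t* = rmx (fun x y => F y x).
Proof. by apply/matrixP => i j; rewrite !mxE; apply: conjc_real. Qed.

Lemma normsq_rvec v : normsq (rvec v) = (\sum_x v x ^+ 2)%:C.
Proof.
rewrite -(sum_enum_val (fun x => v x ^+ 2)) rmorph_sum.
apply: eq_bigr => i _; rewrite mxE normc_def /= expr0n addr0 sqrtr_sqr.
by rewrite -rmorphXn real_normK ?num_real.
Qed.

Lemma rmx_unitary F : (forall x z, \sum_y F x y * F z y = (x == z)%:R) ->
  rmx F \is unitarymx.
Proof. by move=> h; apply/unitarymxP; rewrite trmxC_rmx mul_rmx -rmx1; apply: eq_rmx. Qed.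

(** For the start state this is Grover's diffusion operator. *)
Definition reflection v : 'M[R[i]]_#|B| :=
  rmx (fun x y => 2 * v x * v y - (x == y)%:R).

Lemma sum_delta v x : \sum_y (x == y)%:R * v y = v x.
Proof.
rewrite (bigD1 x) //= eqxx mul1r big1 ?addr0 // => y.
by rewrite eq_sym => /negbTE ->; rewrite mul0r.
Qed.

Lemma mul_reflection v w :
  reflection v *m rvec w = rvec (fun x => 2 * v x * (\sum_y v y * w y) - w x).
Proof.
rewrite mul_rmx_rvec; apply: eq_rvec => x.
under eq_bigr do rewrite mulrBl.
rewrite sumrB sum_delta; congr (_ - _).
by rewrite mulr_sumr; apply: eq_bigr => y _; rewrite mulrA.
Qed.

Lemma reflection_unitary v : \sum_x v x ^+ 2 = 1 -> reflection v \is unitarymx.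
Proof.
move=> v1; apply: rmx_unitary => x z.
rewrite (eq_bigr (fun y => 4 * v x * v z * v y ^+ 2
  - (z == y)%:R * (2 * v x * v y) - (x == y)%:R * (2 * v z * v y)
  + (x == y)%:R * (z == y)%:R)) => [|y _]; last by ring.
rewrite big_split /= !sumrB !sum_delta -mulr_sumr v1 [z == x]eq_sym.
by ring.
Qed.

End Real_matrices.

Lemma oracle_rvec (R : realType) n (W : finType) (f : oracle n) (v : basis n W -> R) :
  oracle_mx R W f *m rvec v = rvec (fun l => (-1) ^+ (l.1.2 && f l.1.1) * v l).
Proof.
apply/colP => i; rewrite oracle_mxE !mxE rmorphM rmorphXn rmorphN1; congr (_ * _).
Qed.

(** * Exact Grover search for the prefix, then one query for the suffix *)

Section Algorithm.
Variables (R : realType) (n k t : nat).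
Hypotheses (kn : (k <= n)%N) (t0 : (0 < t)%N) (t_large : (2 ^ (n - k) <= t ^ 2)%N).

Local Notation B := (basis n unit).
Local Notation theta := (angle R t).

Lemma sum_basis (V : zmodType) (F : B -> V) :
  \sum_l F l = \sum_x (F (x, true, tt) + F (x, false, tt)).
Proof.
rewrite (eq_bigr (fun x => \sum_b F (x, b, tt))) => [|x _]; last by rewrite big_bool.
rewrite pair_bigA /= (reindex (fun p : bits n * bool => (p, tt))) /=.
  by apply: eq_bigr => -[].
by exists fst => [|[p []]].
Qed.

(* The query-free state [|0>|0>] absorbs the part of the norm that the
   [2 ^ (n - k)] amplitudes [sin theta] leave over; this lets Grover's rotation
   angle be chosen so that the search is exact. *)
Definition start (l : B) : R :=
  let: (x, b, _) := l in
  if b then (is_prefix k x)%:R * sin theta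
  else (x == [ffun=> false])%:R * Num.sqrt (1 - (2 ^ (n - k))%:R * sin theta ^+ 2).

Lemma start_unit : \sum_l start l ^+ 2 = 1.
Proof.
have nat_sqr (b : bool) : b%:R ^+ 2 = b%:R :> R by case: b; rewrite ?expr1n ?expr0n.
rewrite sum_basis big_split /=.
under eq_bigr do rewrite exprMn nat_sqr.
under [X in _ + X]eq_bigr do rewrite exprMn nat_sqr eq_sym.
rewrite (sum_delta (fun=> _)) -mulr_suml sqr_sqrtr; last first.
  by rewrite subr_ge0 sqr_sin_angle.
have -> : (2 ^ (n - k))%:R = \sum_(x : bits n) (is_prefix k x)%:R :> R.
  rewrite -(card_prefix kn) -sum1_card natr_sum big_mkcond.
  by apply: eq_bigr => x _; rewrite inE; case: is_prefix.
by rewrite addrC subrK.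
Qed.

Definition ket (x : bits n) (l : B) : R := (l == (x, true, tt))%:R.

Definition suffix_hadamard : 'M[R[i]]_#|B| :=
  rmx (fun l m : B => (l.1.2 == m.1.2)%:R * hadamard R k l.1.1 m.1.1).

Lemma suffix_hadamard_orth (l m : B) :
  \sum_(p : B) ((l.1.2 == p.1.2)%:R * hadamard R k l.1.1 p.1.1) *
         ((m.1.2 == p.1.2)%:R * hadamard R k m.1.1 p.1.1) = (l == m)%:R.
Proof.
rewrite sum_basis; case: l m => [[x b] []] [[z c] []] /=.
rewrite !xpair_eqE eqxx andbT -mulnb natrM -(hadamard_orth R k x z) mulr_suml.
by apply: eq_bigr => y _; case: b; case: c => /=; ring.
Qed.

Lemma suffix_hadamard_unitary : suffix_hadamard \is unitarymx.
Proof. exact/rmx_unitary/suffix_hadamard_orth. Qed.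

Definition superposed (x : bits n) (l : B) : R := l.1.2%:R * hadamard R k l.1.1 x.

Lemma hadamard_ket x : suffix_hadamard *m rvec (ket x) = rvec (superposed x).
Proof.
rewrite mul_rmx_rvec; apply: eq_rvec => l.
under eq_bigr do rewrite mulrC /ket eq_sym.
by rewrite sum_delta /= eqb_id.
Qed.

Lemma hadamard_superposed x :
  suffix_hadamard *m rvec (superposed x) = rvec (ket x).
Proof.
rewrite mul_rmx_rvec; apply: eq_rvec => l.
rewrite /ket -suffix_hadamard_orth; apply: eq_bigr => m _ /=.
by rewrite /superposed [hadamard _ _ x _]hadamardC; case: m.1.2.
Qed.

Section Run.
Variable a : bits n.
Let target := prefix_part k a.
Let f := hybrid_oracle k a.

(** The Bernstein-Vazirani step: the query turns the transform of the prefix into minus that of [a],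
    and the transform is its own inverse. *)
Lemma hadamard_query_target :
  suffix_hadamard *m (oracle_mx R unit f *m (suffix_hadamard *m rvec (ket target)))
  = - rvec (ket a).
Proof.
have -> : oracle_mx R unit f *m (suffix_hadamard *m rvec (ket target))
    = - rvec (superposed a).
  rewrite hadamard_ket oracle_rvec; apply/colP => i; rewrite !mxE -rmorphN.
  congr (_%:C); rewrite /superposed.
  case: (enum_val i) => [[y []] []] /=; last by rewrite !mul0r mulr0 oppr0.
  by rewrite !mul1r oracle_hadamard.
by rewrite mulmxN hadamard_superposed.
Qed.

(* [residue / cos theta] is the unit vector along the unmarked part of [start]. *)
Definition residue (l : B) : R := start l - sin theta * ket target l.

Definition grover_state j : B -> R := fun l =>
  sin ((2 * j%:R + 1) * theta) * ket target l
  + cos ((2 * j%:R + 1) * theta) / cos theta * residue l.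

Lemma grover_state0 : start =1 grover_state 0.
Proof.
move=> l; rewrite /grover_state /residue mulr0 add0r mul1r divff ?gt_eqF ?cos_angle_gt0 //.
by ring.
Qed.

Lemma start_target : \sum_l start l * ket target l = sin theta.
Proof.
under eq_bigr do rewrite mulrC /ket eq_sym.
by rewrite sum_delta /= prefix_partK mul1r.
Qed.

Lemma start_residue : \sum_l start l * residue l = cos theta ^+ 2.
Proof.
rewrite (eq_bigr (fun l => start l ^+ 2 - sin theta * (start l * ket target l))).
  by rewrite sumrB start_unit -mulr_sumr start_target cos2sin2 expr2.
by move=> l _; rewrite /residue; ring.
Qed.

(** [residue] vanishes at every label the query flips: with the query bit set, [start] lives on
    zero-suffix inputs, of which only [target] is marked. *)
Lemma oracle_grover_state j :
  oracle_mx R unit f *m rvec (grover_state j) =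
  rvec (fun l => - sin ((2 * j%:R + 1) * theta) * ket target l
    + cos ((2 * j%:R + 1) * theta) / cos theta * residue l).
Proof.
rewrite oracle_rvec; apply: eq_rvec => l; rewrite /grover_state mulrDr mulNr.
case: l => [[x b] []]; rewrite /residue /ket !xpair_eqE eqxx andbT /=.
case: b => /=; last by rewrite !andbF expr0 !mul1r !mulr0 oppr0.
rewrite !andbT; case px: (is_prefix k x); last first.
  have /negbTE -> : x != target by apply: contraFneq px => ->; apply: prefix_partK.
  by rewrite !mulr0 !mul0r subrr !mulr0 oppr0.
rewrite hybrid_oracle_prefixr // eq_sym -/target; case: eqP => _.
  by rewrite mul1r !mulr1 subrr !mulr0 expr1 mulN1r.
by rewrite expr0 !mulr0 !mul1r oppr0.
Qed.

Lemma grover_iteration j :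
  reflection start *m (oracle_mx R unit f *m rvec (grover_state j))
  = rvec (grover_state j.+1).
Proof.
have c0 : cos theta != 0 by rewrite gt_eqF ?cos_angle_gt0.
rewrite oracle_grover_state mul_reflection; apply: eq_rvec => l.
set s := sin _; set c := cos _.
rewrite (eq_bigr (fun m => - s * (start m * ket target m)
   + c / cos theta * (start m * residue m))) => [|m _]; last by ring.
rewrite big_split /= -!mulr_sumr start_target start_residue.
rewrite /grover_state sin_step cos_step -/s -/c cos_mid -/s -/c.
have -> : start l = sin theta * ket target l + residue l.
  by rewrite /residue addrC subrK.
by field.
Qed.

Lemma grover_state_end : rvec (grover_state t) = rvec (ket target).
Proof.
apply: eq_rvec => l; rewrite /grover_state angle_end sin_pihalf cos_pihalf.
by rewrite !mul0r addr0 mul1r.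
Qed.

End Run.

(** The run begins in [start], so the first unitary is trivial; step [t] merges the last reflection
    with the first Hadamard transform, as no query separates them. *)
Definition identify_step (j : 'I_t.+2) : 'M[R[i]]_#|B| :=
  if (j == 0 :> nat)%N then 1%:M
  else if (j < t)%N then reflection start
  else if (j == t :> nat)%N then suffix_hadamard *m reflection start
  else suffix_hadamard.

Lemma identify_step_unitary j : identify_step j \is unitarymx.
Proof.
have rU := reflection_unitary start_unit.
have hU := suffix_hadamard_unitary.
rewrite /identify_step; case: ifP => _.
  by apply/unitarymxP; rewrite trmx1 map_mx1 mulmx1.
case: ifP => _; first exact: rU.
by case: ifP => _; [exact: (mul_unitarymx hU rU) | exact: hU].
Qed.

(** A computational basis measurement whose input register [x] is reported as
    [hybrid_oracle k x]. *)
Definition identify_meas (g : oracle n) : 'M[R[i]]_#|B| :=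
  rmx (fun l m : B => (l == m)%:R * (hybrid_oracle k l.1.1 == g)%:R).

Lemma identify_meas_complete :
  \sum_g (identify_meas g)^t* *m identify_meas g = 1%:M.
Proof.
rewrite -rmx1; apply/matrixP => i j; rewrite summxE mxE.
under eq_bigr do rewrite trmxC_rmx mul_rmx mxE.
rewrite -rmorph_sum /=; congr (_%:C).
move: (enum_val i) (enum_val j) => l m.
rewrite (eq_bigr (fun g => (hybrid_oracle k l.1.1 == g)%:R * (l == m)%:R)).
  by rewrite (sum_delta (fun=> _)).
move=> g _; under eq_bigr => p _ do rewrite eq_sym -mulrA.
rewrite sum_delta; case: (_ == g); last by rewrite !mul0r.
by rewrite mul1r mulr1 mul1r.
Qed.

Lemma start_state_unit : normsq (rvec start) = 1.
Proof. by rewrite normsq_rvec start_unit rmorph1. Qed.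

Definition identify : qalgorithm R n t.+1 :=
  QAlgorithm start_state_unit identify_step_unitary identify_meas_complete.

Lemma identify_grover a j : (j < t)%N ->
  state_after identify (hybrid_oracle k a) j = rvec (grover_state a j).
Proof.
elim: j => [_|j IH jt] /=.
  by rewrite /identify_step /= mul1mx; apply: eq_rvec (grover_state0 a).
rewrite IH ?(ltnW jt) // /identify_step inordK ?jt; last by rewrite ltnS ltnW // ltnW.
exact: grover_iteration.
Qed.

Lemma identify_final a :
  state_after identify (hybrid_oracle k a) t.+1 = - rvec (ket a).
Proof.
have last_grover : state_after identify (hybrid_oracle k a) t =
    suffix_hadamard *m rvec (ket (prefix_part k a)).
  have step_t j : j.+1 = t -> state_after identify (hybrid_oracle k a) j.+1 =
      suffix_hadamard *m rvec (ket (prefix_part k a)).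
    move=> jt; rewrite /= identify_grover -?jt // /identify_step jt.
    rewrite inordK ?ltnS // ltnn eqxx gtn_eqF // -mulmxA grover_iteration jt.
    by rewrite grover_state_end.
  by have := step_t t.-1; rewrite prednK // => ->.
rewrite /= last_grover /identify_step inordK //= ltnNge leqnSn /= gtn_eqF //.
exact: hadamard_query_target.
Qed.

Lemma identify_solves : solves_OIP identify (hybrid n k).
Proof.
move=> _ /imsetP [a _ ->]; rewrite /output_prob.
(* The projection for [f_a] fixes the basis state of [a], so the algorithm succeeds with
   certainty. *)
have -> : meas identify (hybrid_oracle k a) *m state_after identify (hybrid_oracle k a) t.+1
    = state_after identify (hybrid_oracle k a) t.+1.
  rewrite identify_final mulmxN mul_rmx_rvec; congr (- _); apply: eq_rvec => l.
  under eq_bigr do rewrite -mulrA.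
  rewrite sum_delta /ket; case: (eqVneq l (a, true, tt)) => [->|_]; last by rewrite mulr0.
  by rewrite eqxx mul1r.
by rewrite normsq_state ler_pdivrMr ?mul1r ?ler_nat ?ltr0n.
Qed.

End Algorithm.

(** * Query complexity of the hybrid family *)

(** Zero-suffix inputs reveal the prefix; then the prefix with the single suffix bit [i] set reveals
    the negation of bit [i]. *)
Lemma hybrid_oracle_inj (n k : nat) : injective (@hybrid_oracle n k).
Proof.
move=> a b fab.
have pab : prefix_part k a = prefix_part k b.
  apply/eqP; rewrite eq_sym -hybrid_oracle_prefixr ?prefix_partK //.
  by rewrite -fab hybrid_oracle_prefixr ?prefix_partK.
apply/ffunP => i; case: (ltnP i (n - k)) => ik.
  by move/ffunP: pab => /(_ i); rewrite !ffunE ik.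
pose y : bits n := [ffun j : 'I_n => ((j < n - k)%N && a j) || (j == i)].
have py : prefix_part k y = prefix_part k a.
  apply/ffunP => j; rewrite !ffunE; case: (ltnP j (n - k)) => //= jk.
  by rewrite -val_eqE ltn_eqF ?orbF // (leq_trans jk).
have probe c : prefix_part k c = prefix_part k y -> hybrid_oracle k c y = ~~ c i.
  move=> cy; rewrite ffunE same_prefixE cy eqxx (bigD1 i) //= big1 => [|j /andP[jk ji]].
    by rewrite ffunE eqxx orbT muln1 addn0 modn2 mod0n eqb0 oddb.
  by rewrite ffunE ltnNge jk (negbTE ji) muln0.
by apply: negb_inj; rewrite -!probe ?py // fab.
Qed.

Section Query_bounds.
Variables (R : realType) (n k : nat).

Variables (t : nat) (A : qalgorithm R n t).
Hypothesis A_solves : solves_OIP A (hybrid n k).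

Lemma solves_hybrid a :
  2 / 3 <= output_prob A (hybrid_oracle k a) (hybrid_oracle k a).
Proof. by apply/A_solves/imset_f. Qed.

Lemma hybrid_search_bound : (k <= n)%N -> (2 ^ (n - k) <= 12 * t ^ 2 + 3)%N.
Proof.
move=> kn; rewrite -(card_prefix kn) -card_sig.
pose F (p : {x : bits n | is_prefix k x}) := hybrid_oracle k (val p).
apply: (@card_le_sqr_queries R n t A _ F) => [x p q||p]; last exact: solves_hybrid.
  rewrite /F !hybrid_oracle_prefixl ?(valP p) ?(valP q) // => /eqP px /eqP qx.
  by apply: val_inj; rewrite px qx.
by move=> p q /hybrid_oracle_inj; apply: val_inj.
Qed.

End Query_bounds.

Lemma hybrid_query_gt0 (R : realType) (n k t : nat) (A : qalgorithm R n t) :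
  solves_OIP A (hybrid n k) -> (0 < n)%N -> (0 < t)%N.
Proof.
case: t A => // A A_solves n0.
pose f : oracle n := hybrid_oracle k [ffun=> false].
pose g : oracle n := hybrid_oracle k [ffun=> true].
have fg : f != g.
  apply/eqP => /hybrid_oracle_inj /ffunP /(_ (Ordinal n0)).
  by rewrite !ffunE.
have := sum_output_prob A f.
rewrite (bigD1 f) //= (bigD1 g) 1?eq_sym //= addrA => sum1.
(* Without queries the final state ignores the oracle, so [output_prob A f g] is convertible to
   [output_prob A g g]. *)
have : 2 / 3 + 2 / 3 + 0 <= 1 :> R[i].
  rewrite -[leRHS]sum1 !lerD //; first exact: (solves_hybrid A_solves [ffun=> false]).
    exact: (solves_hybrid A_solves [ffun=> true]).
  by apply: sumr_ge0 => h _; apply: normsq_ge0.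
by rewrite addr0 -mulrDl ler_pdivrMr ?ltr0n // mul1r -natrD ler_nat.
Qed.

Theorem theorem7 (R : realType) :
  exists (c C : R) (n0 : nat), 0 < c /\ 0 < C /\
    forall n k : nat, (n0 <= n)%N -> (k <= n)%N ->
      exists q : nat, is_query_complexity R (hybrid n k) q /\
        c * Num.sqrt (2 ^+ n / 2 ^+ k) <= q%:R /\
        q%:R <= C * Num.sqrt (2 ^+ n / 2 ^+ k).
Proof.
(* With [M = 2^(n-k)] and [q > 0], [M <= 12q^2 + 3 <= 16q^2] gives 1/4, and
   [q^2 <= (t+1)^2 <= 4t^2 <= 8M <= 9M] gives 3. Taking [n >= 1] ensures two distinct oracles, hence
   [q > 0]. *)
exists 4^-1, 3, 1%N; split; first by rewrite invr_gt0.
split=> // n k n0 kn.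
(* The least power of two whose square is at least [2^(n-k)]; rounding the exponent up at most
   doubles that square. *)
pose t := (2 ^ uphalf (n - k))%N.
have t0 : (0 < t)%N by rewrite expn_gt0.
have t_sqr : (t ^ 2 = 2 ^ odd (n - k) * 2 ^ (n - k))%N.
  rewrite -expnM -expnD uphalf_half; congr (2 ^ _)%N.
  by have := odd_double_half (n - k); lia.
have t_large : (2 ^ (n - k) <= t ^ 2)%N.
  by rewrite t_sqr leq_pmull // expn_gt0.
have t_small : (t ^ 2 <= 2 * 2 ^ (n - k))%N.
  by rewrite t_sqr leq_mul2r; case: odd; rewrite ?orbT.
(* Solvability is made boolean classically so that a least query count can be extracted. *)
pose solvable q := `[< exists A : qalgorithm R n q, solves_OIP A (hybrid n k) >].
have ex_solvable : exists q, solvable q.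
  exists t.+1; apply/asboolP; exists (identify R kn t0 t_large).
  exact: identify_solves.
have [q /asboolP [A A_solves] q_min] := ex_minnP ex_solvable.
exists q; split.
  by split=> [|r r_solvable]; [exists A | apply: q_min; apply/asboolP].
have q_le : (q <= t.+1)%N.
  by apply: q_min; apply/asboolP; exists (identify R kn t0 t_large); apply: identify_solves.
have q_gt0 := hybrid_query_gt0 A_solves n0.
have q_ge := hybrid_search_bound A_solves kn.
have -> : 2 ^+ n / 2 ^+ k = (2 ^ (n - k))%:R :> R.
  by rewrite natrX expfB_cond ?pnatr_eq0 // kn.
set M := (2 ^ (n - k))%N in q_ge t_small *.
have sqrt_nat m : Num.sqrt (m ^ 2)%:R = m%:R :> R.
  by rewrite natrX sqrtr_sqr ger0_norm.
split.
  rewrite mulrC ler_pdivrMr // -natrM -(sqrt_nat (q * 4)%N) ler_wsqrtr // ler_nat.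
  by nia.
rewrite -(sqrt_nat 3%N) -(sqrt_nat q) -sqrtrM // -natrM ler_wsqrtr // ler_nat.
by nia.
Qed.
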